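(* Let $\mathcal C_3$ be the set of all qubit channels whose Choi state has rank three, and let $\mathcal U_3\subseteq\mathcal C_3$ be the set of those $\Lambda\in\mathcal C_3$ for which the final shared state $(\mathbf I\otimes\Lambda)(|\Phi_1\rangle\langle\Phi_1|)$, obtained by sending one half of the Bell state $|\Phi_1\rangle=\frac{1}{\sqrt2}(|00\rangle+|11\rangle)$ through $\Lambda$, is useful for universal quantum teleportation (UQT). Then $\mathcal U_3$ is a nonempty strict subset of $\mathcal C_3$.
   Context: A qubit channel is a completely positive trace-preserving linear map $\Lambda$ on $2\times2$ complex matrices. Its Choi state is $\rho_{\Lambda,\Phi_1}=(\mathbf I\otimes\Lambda)(|\Phi_1\rangle\langle\Phi_1|)$. If Alice prepares a two-qubit state $\rho$ and sends one half (the second qubit) through $\Lambda$, the final shared state is $(\mathbf I\otimes\Lambda)(\rho)$. Useful for UQT. For a two-qubit density matrix $\rho$ let $T_\rho$ be the real $3\times3$ matrix with entries $T_{ij}=\mathrm{Tr}(\rho\,\sigma_i\otimes\sigma_j)$ ($\sigma_1,\sigma_2,\sigma_3$ the Pauli matrices). By local unitaries $\rho$ can be brought to a canonical form $\rho_C$ with diagonal correlation matrix $\mathrm{diag}(\tau_1,\tau_2,\tau_3)$, $\tau_k=\lambda_k|t_{kk}|$, $\lambda_k\in\{\pm1\}$, where $|t_{11}|,|t_{22}|,|t_{33}|$ are the singular values of $T_\rho$; if $\det T_\rho\le 0$ all $\lambda_k=-1$, and if $\det T_\rho>0$ the $\lambda_k$ equal $-1$ for the two largest $|t_{kk}|$ and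 $+1$ for the smallest. The maximal average fidelity $F_\rho$ is the average teleportation fidelity (over uniformly distributed pure qubit inputs, standard teleportation protocol, maximized over local unitaries), attained by $\rho_C$, and the fidelity deviation $\Delta_\rho$ is the standard deviation over inputs of the fidelity when $\rho_C$ is used; explicitly $F_\rho=\frac12\bigl(1-\frac13\sum_k\tau_k\bigr)$ and $\Delta_\rho=\frac{1}{3\sqrt{10}}\sqrt{\sum_{i<j}(\tau_i-\tau_j)^2}$. The state $\rho$ is useful for UQT if $F_\rho>\frac23$ and $\Delta_\rho=0$; equivalently, $\det T_\rho<0$ and $|t_{11}|=|t_{22}|=|t_{33}|>\frac13$. *)

(* Defs.v *)
(* MathComp-Analysis; complex numbers are R[i] for R : realType. *)
From HB Require Import structures.
From mathcomp Require Import all_boot all_order all_algebra.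
From mathcomp Require Import complex mxtens.
From mathcomp Require Import all_classical all_reals all_analysis.

Set Implicit Arguments.
Unset Strict Implicit.
Unset Printing Implicit Defensive.

Import Order.TTheory GRing.Theory Num.Theory.
Import numFieldNormedType.Exports.

Local Open Scope classical_set_scope.
Local Open Scope ring_scope.
Local Open Scope sesquilinear_scope.
Local Open Scope complex_scope.

(* In an m * n dimensional tensor product the basis vector |i>|j> has index
   mxtens_index (i, j), as in the Kronecker product A *t B.  Kets are column
   vectors, and M ^t* is the adjoint of M. *)

(* Over R[i], 0 <= z means that z is real and nonnegative, so this condition
   also forces A to be Hermitian. *)
Definition psd (R : realType) (n : nat) (A : 'M[R[i]]_n) : Prop :=
  forall v : 'cV[R[i]]_n, 0 <= (v ^t* *m A *m v) 0 0.

Definition tens_block (R : realType) (k : nat) (A : 'M[R[i]]_(k * 2))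
    (i j : 'I_k) : 'M[R[i]]_2 :=
  \matrix_(a < 2, b < 2) A (mxtens_index (i, a)) (mxtens_index (j, b)).

(* I (x) L on M_k (x) M_2, using A = \sum_(i, j) |i><j| (x) tens_block A i j. *)
Definition id_tens (R : realType) (L : 'M[R[i]]_2 -> 'M[R[i]]_2) (k : nat)
    (A : 'M[R[i]]_(k * 2)) : 'M[R[i]]_(k * 2) :=
  \sum_(i < k) \sum_(j < k) delta_mx i j *t L (tens_block A i j).

Definition completely_positive (R : realType)
    (L : 'M[R[i]]_2 -> 'M[R[i]]_2) : Prop :=
  forall (k : nat) (A : 'M[R[i]]_(k * 2)), psd A -> psd (id_tens L A).

Definition trace_preserving (R : realType)
    (L : 'M[R[i]]_2 -> 'M[R[i]]_2) : Prop :=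
  forall A : 'M[R[i]]_2, \tr (L A) = \tr A.

Definition qubit_channel (R : realType)
    (L : {linear 'M[R[i]]_2 -> 'M[R[i]]_2}) : Prop :=
  completely_positive L /\ trace_preserving L.

Definition ket (R : realType) (a : 'I_2) : 'cV[R[i]]_2 := delta_mx a 0.

Definition ket_proj (R : realType) (n : nat) (v : 'cV[R[i]]_n) : 'M[R[i]]_n :=
  v *m v ^t*.

Definition Phi1 (R : realType) : 'cV[R[i]]_(2 * 2) :=
  ((Num.sqrt 2)^-1)%:C *: (ket R 0 *t ket R 0 + ket R 1 *t ket R 1).

Definition singlet (R : realType) : 'cV[R[i]]_(2 * 2) :=
  ((Num.sqrt 2)^-1)%:C *: (ket R 0 *t ket R 1 - ket R 1 *t ket R 0).

(* Both the Choi state of L and the state finally shared by Alice and Bob when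
   one half of |Phi1> is sent through L. *)
Definition choi_state (R : realType) (L : {linear 'M[R[i]]_2 -> 'M[R[i]]_2}) :
    'M[R[i]]_(2 * 2) :=
  id_tens L (ket_proj (Phi1 R)).

(* pauli 0 is the identity; pauli 1, 2, 3 are sigma_x, sigma_y, sigma_z. *)
Definition pauli (R : realType) (k : 'I_4) : 'M[R[i]]_2 :=
  match val k with
  | 0%N => 1%:M
  | 1%N => delta_mx 0 1 + delta_mx 1 0
  | 2%N => 'i *: (delta_mx 1 0 - delta_mx 0 1)
  | _ => delta_mx 0 0 - delta_mx 1 1
  end.

(* The traces are real when rho is Hermitian. *)
Definition corr_mx (R : realType) (rho : 'M[R[i]]_(2 * 2)) : 'M[R]_3 :=
  \matrix_(i < 3, j < 3)
    complex.Re (\tr (rho *m (pauli R (lift ord0 i) *t pauli R (lift ord0 j)))).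

Definition local_conj (R : realType) (U V : 'M[R[i]]_2)
    (rho : 'M[R[i]]_(2 * 2)) : 'M[R[i]]_(2 * 2) :=
  (U *t V) *m rho *m (U *t V) ^t*.

(* The singular values of T are the nonnegative square roots of the eigenvalues
   of T^T T, listed with multiplicity. *)
Definition singular_values (R : realType) (T : 'M[R]_3)
    (s : 'I_3 -> R) : Prop :=
  (forall k, 0 <= s k) /\
  char_poly (T^T *m T) = \prod_(k < 3) ('X - (s k ^+ 2)%:P).

(* m is the index of a smallest singular value; it carries the sign + exactly
   when the determinant is positive.  The canonical form is unique only up to
   reordering the diagonal, and further local unitaries, neither of which
   affects the statistics of the teleportation fidelity below. *)
Definition correlation_canonical_form (R : realType)
    (rho rhoC : 'M[R[i]]_(2 * 2)) : Prop :=
  exists (U V : 'M[R[i]]_2) (s : 'I_3 -> R) (m : 'I_3),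
    [/\ U \is unitarymx, V \is unitarymx & rhoC = local_conj U V rho] /\
    [/\ singular_values (corr_mx rho) s, forall k, s m <= s k &
        corr_mx rhoC =
          diag_mx (\row_(k < 3)
            ((if (0 < \det (corr_mx rho)) && (k == m) then 1 else -1) * s k))].

(* The input with Bloch angles theta (polar) and phi (azimuthal). *)
Definition input_ket (R : realType) (theta phi : R) : 'cV[R[i]]_2 :=
  (cos (theta / 2))%:C *: ket R 0 +
  ((cos phi +i* sin phi) * (sin (theta / 2))%:C) *: ket R 1.

(* Bell basis, written so that outcome k calls for the correction pauli k: with
   the singlet as shared state the protocol teleports every input perfectly.
   This reference state matches the signs in correlation_canonical_form. *)
Definition bell (R : realType) (k : 'I_4) : 'cV[R[i]]_(2 * 2) :=
  (pauli R k *t 1%:M) *m singlet R.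

(* Input qubit, Alice's half of rho and Bob's half of rho are ordered from left
   to right; Alice measures the first two.  The result is Bob's state for
   outcome k before correction, its trace being the probability of k.  The
   ascriptions identify 2 * (2 * 2) with 2 * 2 * 2 and 1 * 2 with 2, which are
   convertible and compatible with the Kronecker indexing. *)
Definition bob_state (R : realType) (rho : 'M[R[i]]_(2 * 2)) (psi : 'cV[R[i]]_2)
    (k : 'I_4) : 'M[R[i]]_2 :=
  let K : 'M[R[i]]_(2, 2 * 2 * 2) := (bell R k) ^t* *t (1%:M : 'M[R[i]]_2) in
  K *m (ket_proj psi *t rho : 'M[R[i]]_(2 * 2 * 2)) *m K ^t*.

(* Fidelity of the output of the standard protocol with the input psi. *)
Definition tele_fidelity (R : realType) (rho : 'M[R[i]]_(2 * 2))
    (psi : 'cV[R[i]]_2) : R :=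
  complex.Re ((psi ^t* *m
    (\sum_(k < 4) pauli R k *m bob_state rho psi k *m (pauli R k) ^t*) *m
    psi) 0 0).

(* Mean over uniformly distributed pure inputs (the normalized area measure of
   the Bloch sphere). *)
Definition input_mean (R : realType) (g : 'cV[R[i]]_2 -> R) : R :=
  (4 * pi)^-1 *
  (\int[lebesgue_measure]_(phi in `[0%R, (2 * pi)%R])
     (\int[lebesgue_measure]_(theta in `[0%R, pi])
        (g (input_ket theta phi) * sin theta)))%R.

Definition avg_fidelity (R : realType) (rho : 'M[R[i]]_(2 * 2)) : R :=
  input_mean (tele_fidelity rho).

Definition fidelity_std (R : realType) (rho : 'M[R[i]]_(2 * 2)) : R :=
  Num.sqrt
    (input_mean (fun psi => (tele_fidelity rho psi - avg_fidelity rho) ^+ 2)).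

Definition max_avg_fidelity (R : realType) (rho : 'M[R[i]]_(2 * 2)) : R :=
  sup [set x | exists U V : 'M[R[i]]_2,
         [/\ U \is unitarymx, V \is unitarymx &
             x = avg_fidelity (local_conj U V rho)]].

Definition has_fidelity_deviation (R : realType) (rho : 'M[R[i]]_(2 * 2))
    (d : R) : Prop :=
  exists2 rhoC, correlation_canonical_form rho rhoC & d = fidelity_std rhoC.

Definition useful_for_UQT (R : realType) (rho : 'M[R[i]]_(2 * 2)) : Prop :=
  2 / 3 < max_avg_fidelity rho /\ has_fidelity_deviation rho 0.

Definition C3 (R : realType) : set {linear 'M[R[i]]_2 -> 'M[R[i]]_2} :=
  [set L | qubit_channel L /\ \rank (choi_state L) = 3%N].

Definition U3 (R : realType) : set {linear 'M[R[i]]_2 -> 'M[R[i]]_2} :=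
  [set L | C3 L /\ useful_for_UQT (choi_state L)].

(* Main.v *)
(* For an input with Bloch vector n, the four corrected outcomes of the
   protocol cancel both the local Bloch vectors of rho and the off-diagonal
   entries of its correlation matrix T: the fidelity is
   (tr rho - sum_k T_kk n_k^2) / 2, with mean (tr rho - tr T / 3) / 2.  Since
   tr T = tr (rho S) for S = sum_k sigma_k (x) sigma_k = 1 - 4 |singlet><singlet|,
   this mean is at most 1 for every state, and at most 2/3 when rho <= 1/2, a
   condition invariant under local unitaries.

   Both channels needed belong to one family, A |-> (D_c A + tr A |0><0|) / 2,
   where D_c multiplies the coherences of A by c.  The kernel of the Choi state
   is spanned by |01>, so its rank is 3.  For c = 1, T = diag (1/2, -1/2, 1/2):
   rotating Alice's qubit by sigma_y makes T = -1/2, so that the fidelity is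
   constantly 3/4.  For c = 0 the eigenvalues of the Choi state are 1/2, 1/4,
   1/4, 0, so the mean fidelity never exceeds 2/3. *)

Require Import Defs.
From mathcomp Require Import all_boot all_order all_algebra.
From mathcomp Require Import all_classical all_reals all_analysis.
From HB Require Import structures.
From mathcomp Require Import complex mxtens ring lra.

Set Implicit Arguments.
Unset Strict Implicit.
Unset Printing Implicit Defensive.

Import Order.TTheory GRing.Theory Num.Theory.
Import numFieldNormedType.Exports.

Local Open Scope classical_set_scope.
Local Open Scope ring_scope.
Local Open Scope sesquilinear_scope.
Local Open Scope complex_scope.

(** * Finite index sets *)

Local Notation lit n k := (@Ordinal n k isT).

Lemma big_ord2 (V : nmodType) (F : 'I_2 -> V) :
  \sum_i F i = F (lit 2 0) + F (lit 2 1).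
Proof.
rewrite !big_ord_recr big_ord0 /= add0r.
by congr (F _ + F _); exact: val_inj.
Qed.

Lemma big_ord3 (V : nmodType) (F : 'I_3 -> V) :
  \sum_i F i = F (lit 3 0) + F (lit 3 1) + F (lit 3 2).
Proof.
rewrite !big_ord_recr big_ord0 /= add0r.
by congr (F _ + F _ + F _); exact: val_inj.
Qed.

Lemma big_ord4 (V : nmodType) (F : 'I_4 -> V) :
  \sum_i F i = F (lit 4 0) + F (lit 4 1) + F (lit 4 2) + F (lit 4 3).
Proof.
rewrite !big_ord_recr big_ord0 /= add0r.
by congr (F _ + F _ + F _ + F _); exact: val_inj.
Qed.

Lemma big_ord8 (V : nmodType) (F : 'I_8 -> V) :
  \sum_i F i = F (lit 8 0) + F (lit 8 1) + F (lit 8 2) + F (lit 8 3) +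
               F (lit 8 4) + F (lit 8 5) + F (lit 8 6) + F (lit 8 7).
Proof.
rewrite !big_ord_recr big_ord0 /= add0r.
by do ![congr (_ + _)]; congr (F _); exact: val_inj.
Qed.

(** Decides comparisons of literal indices by computation, so that Kronecker deltas in concrete
    matrix entries become numerals. Comparisons that do not reduce to a Boolean constant are left
    alone. *)
Ltac eval_eq :=
  repeat match goal with
  | |- context [ @eq_op ?T ?x ?y ] =>
    let b := eval vm_compute in (@eq_op T x y) in
    match b with true => idtac | false => idtac end;
    change (@eq_op T x y) with b
  end.

(** Case analysis produces ordinals carrying various bound proofs; this brings them back to the
    constants 0 and 1 used in the definitions. *)
Ltac eval_ord2 :=
  repeat match goal with
  | |- context [ @Ordinal 2 ?m ?p ] =>
    let b := eval vm_compute in (m == 0%N) in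
    match b with
    | true => rewrite (_ : @Ordinal 2 m p = 0); last exact: val_inj
    | false => rewrite (_ : @Ordinal 2 m p = 1); last exact: val_inj
    end
  end.

(** * Complex numbers and matrices *)

Lemma ReD (R : realType) (x y : R[i]) :
  complex.Re (x + y) = complex.Re x + complex.Re y.
Proof. by case: x y => [? ?] []. Qed.

Lemma ReB (R : realType) (x y : R[i]) :
  complex.Re (x - y) = complex.Re x - complex.Re y.
Proof. by case: x y => [? ?] []. Qed.

Lemma Re_realM (R : realType) (a : R) (z : R[i]) :
  complex.Re (a%:C * z) = a * complex.Re z.
Proof. by case: z => u v /=; rewrite mul0r subr0. Qed.

Lemma conjC_realM (R : realType) (a : R) (z : R[i]) :
  Num.conj (a%:C * z) = a%:C * Num.conj z.
Proof. by rewrite rmorphM /=; congr (_ * _); exact: conjc_real. Qed.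

Lemma imaginary_sqr (R : realType) :
  (Num.imaginary : R[i]) * Num.imaginary = -1.
Proof. by rewrite -expr2 sqrCi. Qed.

Lemma conj_imaginary (R : realType) :
  Num.conj (Num.imaginary : R[i]) = - Num.imaginary.
Proof. exact: conjCi. Qed.

Lemma invsqrt2_sqr (R : realType) :
  ((Num.sqrt 2)^-1)%:C * ((Num.sqrt 2)^-1)%:C = 2^-1 :> R[i].
Proof.
rewrite -rmorphM /= -invfM -expr2 sqr_sqrtr ?ler0n //.
by rewrite fmorphV rmorph_nat.
Qed.

Lemma mxtraceB (R : pzRingType) n (A B : 'M[R]_n) :
  \tr (A - B) = \tr A - \tr B.
Proof. exact: linearB. Qed.

Lemma char_poly_scalar (R : comNzRingType) n (a : R) :
  char_poly (a%:M : 'M[R]_n) = ('X - a%:P) ^+ n.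
Proof.
rewrite /char_poly /char_poly_mx map_scalar_mx -det_scalar.
by congr (\det _); rewrite -raddfB.
Qed.

Lemma delta_mx_conj (R : pzRingType) m n p q (i : 'I_m) (j : 'I_n) (k : 'I_p)
    (l : 'I_q) (A : 'M[R]_(n, p)) :
  delta_mx i j *m A *m delta_mx k l = A j k *: delta_mx i l.
Proof.
apply/matrixP => x y.
rewrite [LHS]mxE (bigD1 k) //= big1 ?addr0 => [|z nz]; last first.
  by rewrite [delta_mx k l _ _]mxE (negbTE nz) mulr0.
rewrite [(_ *m A) _ _]mxE (bigD1 j) //= big1 ?addr0 => [|z nz]; last first.
  by rewrite !mxE (negbTE nz) andbF mul0r.
rewrite !mxE !eqxx andbT.
by case: (x == i); rewrite /= ?(mul0r, mulr0, mul1r).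
Qed.

Lemma tensmxDr (R : pzRingType) m n p q (A : 'M[R]_(m, n)) (B C : 'M[R]_(p, q)) :
  A *t (B + C) = A *t B + A *t C.
Proof. by apply/matrixP => i j; rewrite !mxE mulrDr. Qed.

Lemma tensmxZr (R : comPzRingType) m n p q (A : 'M[R]_(m, n)) (a : R)
    (B : 'M[R]_(p, q)) :
  A *t (a *: B) = a *: (A *t B).
Proof. by apply/matrixP => i j; rewrite !mxE mulrCA. Qed.

Lemma adjmx_tens (C : numClosedFieldType) m n p q (A : 'M[C]_(m, n))
    (B : 'M[C]_(p, q)) :
  (A *t B) ^t* = A ^t* *t B ^t*.
Proof. by apply/matrixP => i j; rewrite !mxE rmorphM. Qed.

Lemma adjmxM (C : numClosedFieldType) m n p (A : 'M[C]_(m, n))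
    (B : 'M[C]_(n, p)) :
  (A *m B) ^t* = B ^t* *m A ^t*.
Proof. by rewrite trmx_mul map_mxM. Qed.

Lemma adjmx_mulmxE (C : numClosedFieldType) n (r : 'rV[C]_n) i j :
  (r ^t* *m r) i j = Num.conj (r 0 i) * r 0 j.
Proof. by rewrite mxE big_ord1 !mxE. Qed.

Lemma unitarymx1 (C : numClosedFieldType) n : (1%:M : 'M[C]_n) \is unitarymx.
Proof. by apply/unitarymxP; rewrite trmx1 map_mx1 mulmx1. Qed.

Definition mx4 (T : nmodType) (s : seq (seq T)) : 'M[T]_(2 * 2) :=
  \matrix_(i < 2 * 2, j < 2 * 2) (nth [::] s i)`_j.

Definition col4 (T : nmodType) (s : seq T) : 'cV[T]_(2 * 2) :=
  \col_(i < 2 * 2) s`_i.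

(** * Positive semidefinite matrices and completely positive maps *)

Lemma psd_conj (R : realType) m n (W : 'M[R[i]]_(m, n)) (A : 'M[R[i]]_n) :
  psd A -> psd (W *m A *m W ^t*).
Proof.
move=> psdA v; rewrite !mulmxA -(trmxCK W) -adjmxM -mulmxA.
by rewrite trmxCK; exact: psdA.
Qed.

Lemma psdD (R : realType) n (A B : 'M[R[i]]_n) :
  psd A -> psd B -> psd (A + B).
Proof. by move=> pA pB v; rewrite mulmxDr mulmxDl mxE addr_ge0 ?pA ?pB. Qed.

Lemma psdZ (R : realType) n (a : R[i]) (A : 'M[R[i]]_n) :
  0 <= a -> psd A -> psd (a *: A).
Proof.
by move=> a0 pA v; rewrite -scalemxAr -scalemxAl mxE mulr_ge0.
Qed.

Lemma psd_ket_proj (R : realType) n (v : 'cV[R[i]]_n) : psd (ket_proj v).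
Proof.
move=> w; rewrite /ket_proj !mulmxA -mulmxA -{2}(trmxCK w) -adjmxM.
rewrite mxE big_ord1 [_^t* _ _]mxE [_^T _ _]mxE.
exact: mul_conjC_ge0.
Qed.

(** By cyclicity the trace is a multiple of v^* A v. The natural factor fits the weights in the
    decompositions of [heisenberg] below. *)
Lemma psd_mxtrace_proj (R : realType) n (A : 'M[R[i]]_n) (v : 'cV[R[i]]_n)
    (a : nat) :
  psd A -> 0 <= complex.Re (\tr (A *m (a%:R *: ket_proj v))).
Proof.
move=> psdA; rewrite -scalemxAr mxtraceZ -(rmorph_nat (real_complex R)) Re_realM.
rewrite mulr_ge0 ?ler0n // /ket_proj mulmxA mxtrace_mulC mulmxA /mxtrace big_ord1.
by have := psdA v; rewrite lecE /= => /andP[].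
Qed.

Lemma tens_block_sum (R : realType) k (A : 'M[R[i]]_(k * 2)) :
  A = \sum_i \sum_j delta_mx i j *t tens_block A i j.
Proof.
apply/matrixP => x y.
case: (mxtens_indexP x) => i a; case: (mxtens_indexP y) => j b.
rewrite summxE (bigD1 i) //= [X in _ + X]big1; last first.
  move=> i' ni; rewrite summxE big1 // => j' _.
  by rewrite tensmxE !mxE eq_sym (negbTE ni) mul0r.
rewrite addr0 summxE (bigD1 j) //= [X in _ + X]big1; last first.
  by move=> j' nj; rewrite tensmxE !mxE eqxx eq_sym (negbTE nj) mul0r.
by rewrite addr0 tensmxE !mxE !eqxx mul1r.
Qed.

(** Extending the conjugation by K with the identity gives the conjugation by 1 (x) K, and
    conjugations preserve positivity. *)
Lemma completely_positive_conj (R : realType) (K : 'M[R[i]]_2) :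
  completely_positive (fun A => K *m A *m K ^t*).
Proof.
move=> k A psdA.
have -> : id_tens (fun A => K *m A *m K ^t*) A =
    (1%:M *t K) *m A *m (1%:M *t K) ^t*.
  rewrite [in RHS](tens_block_sum A) mulmx_sumr mulmx_suml.
  apply: eq_bigr => i _; rewrite mulmx_sumr mulmx_suml.
  apply: eq_bigr => j _.
  by rewrite adjmx_tens !tensmx_mul trmx1 map_mx1 mul1mx mulmx1.
exact: psd_conj.
Qed.

Lemma completely_positiveD (R : realType) (L M : 'M[R[i]]_2 -> 'M[R[i]]_2) :
  completely_positive L -> completely_positive M ->
  completely_positive (fun A => L A + M A).
Proof.
move=> cL cM k A psdA.
have -> : id_tens (fun A => L A + M A) A = id_tens L A + id_tens M A.
  rewrite -big_split; apply: eq_bigr => i _.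
  by rewrite -big_split; apply: eq_bigr => j _; rewrite tensmxDr.
by apply: psdD; [exact: cL | exact: cM].
Qed.

Lemma completely_positiveZ (R : realType) (a : R[i])
    (L : 'M[R[i]]_2 -> 'M[R[i]]_2) :
  0 <= a -> completely_positive L -> completely_positive (fun A => a *: L A).
Proof.
move=> a0 cL k A psdA.
have -> : id_tens (fun A => a *: L A) A = a *: id_tens L A.
  rewrite scaler_sumr; apply: eq_bigr => i _.
  by rewrite scaler_sumr; apply: eq_bigr => j _; rewrite tensmxZr.
by apply: psdZ => //; exact: cL.
Qed.

Lemma psd_choi (R : realType) (L : {linear 'M[R[i]]_2 -> 'M[R[i]]_2}) :
  completely_positive L -> psd (choi_state L).
Proof. by move=> cpL; apply: cpL; exact: psd_ket_proj. Qed.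

(** * Local unitaries *)

Lemma tens_unitary (R : realType) (U V : 'M[R[i]]_2) :
  U \is unitarymx -> V \is unitarymx -> (U *t V) ^t* *m (U *t V) = 1%:M.
Proof.
move=> uU uV; rewrite adjmx_tens tensmx_mul.
have adjK (W : 'M[R[i]]_2) : W \is unitarymx -> W ^t* *m W = 1%:M.
  by rewrite -trmxC_unitary => /unitarymxP; rewrite trmxCK.
rewrite !adjK //; apply/matrixP => i j; rewrite !mxE.
by case: i => [[|[|[|[|//]]]] i4]; case: j => [[|[|[|[|//]]]] j4];
   eval_eq; rewrite /=; ring.
Qed.

Lemma mxtrace_local_conj (R : realType) (U V : 'M[R[i]]_2)
    (rho : 'M[R[i]]_(2 * 2)) :
  U \is unitarymx -> V \is unitarymx -> \tr (local_conj U V rho) = \tr rho.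
Proof.
move=> uU uV; rewrite /local_conj mxtrace_mulC mulmxA.
by rewrite tens_unitary // mul1mx.
Qed.

(** * Mean over the Bloch sphere *)

Lemma Rintegral_antiderivative (R : realType) (f F : R -> R) (a b : R) :
  a < b -> (forall x : R, is_derive x 1 F (f x)) -> continuous f ->
  (\int[lebesgue_measure]_(x in `[a, b]) f x = F b - F a)%R.
Proof.
move=> ab dF cf.
have cF x : {for x, continuous F}.
  apply: differentiable_continuous; apply/derivable1_diffP.
  exact: (@ex_derive _ _ _ _ _ _ _ (dF x)).
rewrite /Rintegral (@continuous_FTC2 _ f F) //.
- by apply: continuous_subspaceT.
- split.
  + by move=> x _; exact: (@ex_derive _ _ _ _ _ _ _ (dF x)).
  + by apply: cvg_at_right_filter; exact: cF.
  + by apply: cvg_at_left_filter; exact: cF.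
- by move=> x _; rewrite derive1E (@derive_val _ _ _ _ _ _ _ (dF x)).
Qed.

Lemma Rintegral_sin_cos2 (R : realType) (a b : R) :
  (\int[lebesgue_measure]_(x in `[0%R, pi]) ((a + b * cos x ^+ 2) * sin x)
   = 2 * a + 2 / 3 * b)%R.
Proof.
have dF (x : R) : is_derive x 1
    (fun x => - a * cos x - b / 3 * cos x ^+ 3) ((a + b * cos x ^+ 2) * sin x).
  by apply: is_derive_eq; rewrite /GRing.scale /=; field.
rewrite (Rintegral_antiderivative (pi_gt0 R) dF).
- by rewrite cospi cos0; field.
- move=> x; apply: differentiable_continuous; apply/derivable1_diffP.
  exact: ex_derive.
Qed.

Lemma Rintegral_cos2 (R : realType) (a b : R) :
  (\int[lebesgue_measure]_(x in `[0%R, 2 * pi]) (a + b * cos x ^+ 2)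
   = (2 * a + b) * pi)%R.
Proof.
have pi2_gt0 : (0 : R) < 2 * pi by rewrite mulr_gt0 ?pi_gt0.
have dF (x : R) : is_derive x 1
    (fun x => a * x + b * (x + sin x * cos x) / 2) (a + b * cos x ^+ 2).
  apply: is_derive_eq; rewrite /GRing.scale /= mulrN -!expr2 sin2cos2.
  by field.
rewrite (Rintegral_antiderivative pi2_gt0 dF).
- by rewrite mulr_natl sin2pi sin0; field.
- move=> x; apply: differentiable_continuous; apply/derivable1_diffP.
  exact: ex_derive.
Qed.

Definition bloch (R : realType) (theta phi : R) (k : 'I_3) : R :=
  match val k with
  | 0%N => sin theta * cos phi
  | 1%N => sin theta * sin phi
  | _ => cos theta
  end.

Lemma sum_bloch2 (R : realType) (theta phi : R) :
  \sum_k bloch theta phi k ^+ 2 = 1.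
Proof.
rewrite big_ord3 /bloch /= !exprMn -mulrDr cos2Dsin2 mulr1 addrC.
exact: cos2Dsin2.
Qed.

(** Each squared coordinate has mean 1/3 on the unit sphere. *)
Lemma input_mean_quadratic (R : realType) (g : 'cV[R[i]]_2 -> R) (a : R)
    (b : 'I_3 -> R) :
  (forall theta phi,
    g (input_ket theta phi) = a + \sum_k b k * bloch theta phi k ^+ 2) ->
  input_mean g = a + (\sum_k b k) / 3.
Proof.
move=> gE; rewrite /input_mean big_ord3.
set b0 := b _; set b1 := b _; set b2 := b _.
have inner phi : (\int[lebesgue_measure]_(theta in `[0%R, pi])
    (g (input_ket theta phi) * sin theta))%R =
    2 * a + b1 * (4 / 3) + b2 * (2 / 3) + (b0 - b1) * (4 / 3) * cos phi ^+ 2.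
  (* For fixed phi, s is the coefficient of sin^2 theta; replacing sin^2 by 1 - cos^2 gives the form
     integrated above. *)
  pose s := b0 * cos phi ^+ 2 + b1 * sin phi ^+ 2.
  rewrite (_ : (fun theta => _) =
    fun theta => (a + s + (b2 - s) * cos theta ^+ 2) * sin theta).
    by rewrite Rintegral_sin_cos2 /s sin2cos2; field.
  apply/funext => theta; rewrite gE; congr (_ * _).
  rewrite big_ord3 -/b0 -/b1 -/b2 /bloch /= !exprMn sin2cos2 /s.
  by ring.
under [X in Rintegral _ _ X]funext do rewrite inner.
rewrite Rintegral_cos2.
have := lt0r_neq0 (pi_gt0 R); move: (pi : R) => p p_neq0.
by field.
Qed.

(** * The teleportation fidelity *)

(* The bra such that outcome k contributes its expectation in rho to the
   fidelity; up to phase and the factor 1 / sqrt 2 it is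
   <phi^perp| (x) <phi| for phi = sigma_k psi. *)
Definition outcome_row (R : realType) (psi : 'cV[R[i]]_2) (k : 'I_4) :
    'M[R[i]]_(1, 2 * 2) :=
  psi ^t* *m pauli R k *m
  ((bell R k) ^t* *t (1%:M : 'M[R[i]]_2) : 'M[R[i]]_(2, 2 * 2 * 2)) *m
  (psi *t (1%:M : 'M[R[i]]_(2 * 2)) : 'M[R[i]]_(2 * 2 * 2, 2 * 2)).

(** Isolates rho as a middle factor, so that each outcome contributes an expression r rho r^* with r
    a row vector. *)
Lemma ket_proj_tens (R : realType) (psi : 'cV[R[i]]_2)
    (rho : 'M[R[i]]_(2 * 2)) :
  (ket_proj psi *t rho : 'M[R[i]]_(2 * 2 * 2)) =
  (psi *t (1%:M : 'M[R[i]]_(2 * 2)) : 'M[R[i]]_(2 * 2 * 2, 2 * 2)) *m rho *m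
  (psi *t (1%:M : 'M[R[i]]_(2 * 2)) : 'M[R[i]]_(2 * 2 * 2, 2 * 2)) ^t*.
Proof.
have adj : (psi *t (1%:M : 'M[R[i]]_(2 * 2))
      : 'M[R[i]]_(2 * 2 * 2, 2 * 2)) ^t* =
    (psi ^t* *t (1%:M : 'M[R[i]]_(2 * 2)) : 'M[R[i]]_(2 * 2, 2 * 2 * 2)).
  by apply/matrixP => x y; rewrite !mxE rmorphM rmorph_nat eq_sym.
(* Reading rho as 1 (x) rho lets the mixed-product rule apply to its product with psi (x) 1. *)
have rhoE : rho = ((1%:M : 'M[R[i]]_1) *t rho : 'M[R[i]]_(1 * (2 * 2))).
  rewrite (tens_scalar1mx rho) /=; apply/matrixP => i j.
  by rewrite castmxE; congr (rho _ _); exact: val_inj.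
have psi_rho : (psi *t (1%:M : 'M[R[i]]_(2 * 2))
    : 'M[R[i]]_(2 * 2 * 2, 2 * 2)) *m rho = psi *t rho.
  rewrite [in LHS]rhoE.
  apply: (etrans (tensmx_mul psi (1%:M : 'M[R[i]]_(2 * 2)) 1%:M rho)).
  by rewrite mulmx1 mul1mx.
rewrite adj psi_rho; symmetry.
apply: (etrans (tensmx_mul psi rho (psi ^t*) 1%:M)).
by rewrite mulmx1.
Qed.

(** Outcome k contributes r rho r^* = tr (rho r^* r), so the fidelity is the expectation in rho of
    an operator that depends on psi alone. *)
Lemma tele_fidelityE (R : realType) (rho : 'M[R[i]]_(2 * 2))
    (psi : 'cV[R[i]]_2) :
  tele_fidelity rho psi = complex.Re (\tr (rho *m
    (\sum_k (outcome_row psi k) ^t* *m outcome_row psi k))).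
Proof.
rewrite /tele_fidelity; congr complex.Re.
rewrite mulmx_sumr mulmx_suml summxE mulmx_sumr raddf_sum.
apply: eq_bigr => k _.
rewrite /= [in RHS]mulmxA [RHS]mxtrace_mulC /bob_state ket_proj_tens.
rewrite /mxtrace big_ord1; congr (fun_of_matrix _ 0 0).
by rewrite /outcome_row !adjmxM !trmxCK !mulmxA.
Qed.

(** In the singlet, |1> on the second qubit is paired with |0> and |0> with -|1>; the second bit of
    j therefore selects the column of the Pauli matrix. *)
Lemma bellE (R : realType) (k j : 'I_4) : bell R k j 0 =
  ((Num.sqrt 2)^-1)%:C *
  (if val j is (0 | 2)%N then - pauli R k (@mxtens_unindex 2 2 j).1 1
   else pauli R k (@mxtens_unindex 2 2 j).1 0).
Proof.
rewrite !mxE big_ord4 /singlet !mxE.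
eval_eq.
case: j => [[|[|[|[|//]]]] ?] /=; eval_eq;
rewrite !(mul0r, mulr0, mul1r, mulr1, addr0, add0r, subr0, sub0r);
rewrite ?(oppr0, mul0r, mulr0, mul1r, mulr1, addr0, add0r, mulrN1, mulrN);
eval_ord2; rewrite ?mulrN; by rewrite mulrC.
Qed.

(** With phi = sigma_k psi, Bob's factor is phi^*. Alice's factor comes from contracting the Bell
    bra with psi, which leaves (-phi_1, phi_0), a bra that annihilates phi. *)
Lemma outcome_rowE (R : realType) (psi : 'cV[R[i]]_2) (k j : 'I_4) :
  outcome_row psi k 0 j =
  ((Num.sqrt 2)^-1)%:C *
  (psi ^t* *m pauli R k) 0 (@mxtens_unindex 2 2 j).2 *
  (if val j is (0 | 1)%N then - ((pauli R k) ^t* *m psi) 1 0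
   else ((pauli R k) ^t* *m psi) 0 0).
Proof.
rewrite /outcome_row; set u := psi ^t* *m pauli R k.
have psiE (x : 'I_(2 * 2 * 2)) : (psi *t (1%:M : 'M[R[i]]_(2 * 2))
    : 'M[R[i]]_(2 * 2 * 2, 2 * 2)) x j =
    psi (@mxtens_unindex 2 (2 * 2) x).1 0 *
    ((@mxtens_unindex 2 (2 * 2) x).2 == (@mxtens_unindex 1 (2 * 2) j).2)%:R.
  by rewrite !mxE [(@mxtens_unindex 1 (2 * 2) j).1]ord1.
have bellE' (a : 'I_2) (x : 'I_(2 * 2 * 2)) :
    ((bell R k) ^t* *t (1%:M : 'M[R[i]]_2) : 'M[R[i]]_(2, 2 * 2 * 2)) a x =
    Num.conj (bell R k (@mxtens_unindex (2 * 2) 2 x).1 0) *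
    (a == (@mxtens_unindex (2 * 2) 2 x).2)%:R.
  rewrite mxE [_^t* _ _]mxE [_^T _ _]mxE [_%:M _ _]mxE.
  rewrite [(@mxtens_unindex 1 2 a).1]ord1.
  suff -> : (@mxtens_unindex 1 2 a).2 = a by [].
  by apply: val_inj; case: a => [[|[|]]].
rewrite mxE big_ord8 !psiE ![in LHS]mxE !big_ord2 !bellE'.
rewrite ![(_ *m psi) _ _]mxE !big_ord2 ![_^t* _ _]mxE ![_^T _ _]mxE !bellE.
case: j {psiE} => [[|[|[|[|//]]]] j4]; eval_eq;
  rewrite /= !(mulr0, mulr1, addr0, add0r); eval_ord2.
all: rewrite !conjC_realM ?rmorphN /=; ring.
Qed.

(** Rows of the table are outcomes. In the row of sigma_y the factors 'i from the two halves combine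
    to signs. *)
Lemma outcome_row_mx4 (R : realType) (psi : 'cV[R[i]]_2) (k j : 'I_4) :
  let x := psi 0 0 in let y := psi 1 0 in
  let xc := Num.conj x in let yc := Num.conj y in
  outcome_row psi k 0 j = ((Num.sqrt 2)^-1)%:C *
   (mx4 [:: [:: - xc * y; - yc * y; xc * x; yc * x];
            [:: - yc * x; - xc * x; yc * y; xc * y];
            [:: yc * x; - xc * x; yc * y; - xc * y];
            [:: xc * y; - yc * y; xc * x; - yc * x]] k j).
Proof.
move=> x y xc yc; rewrite outcome_rowE -mulrA; congr (_ * _).
rewrite !mxE !big_ord2 ![_^t* _ _]mxE ![_^T _ _]mxE.
have [-> ->] : lit 2 0 = 0 /\ lit 2 1 = 1 by split; exact: val_inj.
rewrite -/x -/y -/xc -/yc /pauli.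
have ii := imaginary_sqr R; have ic := conj_imaginary R.
by case: k => [[|[|[|[|//]]]] k4]; case: j => [[|[|[|[|//]]]] j4];
  rewrite /= !mxE; eval_eq;
  rewrite /= ?(rmorphM, rmorphD, rmorphB, rmorphN, rmorph0, rmorph1) /= ?ic;
  ring: ii.
Qed.

Definition pauli2 (R : realType) (k : 'I_3) : 'M[R[i]]_(2 * 2) :=
  pauli R (lift ord0 k) *t pauli R (lift ord0 k).

Lemma pauli2E (R : realType) :
  [/\ pauli2 R (lit 3 0) = mx4 [:: [:: 0; 0; 0; 1]; [:: 0; 0; 1; 0];
                                   [:: 0; 1; 0; 0]; [:: 1; 0; 0; 0]],
      pauli2 R (lit 3 1) = mx4 [:: [:: 0; 0; 0; -1]; [:: 0; 0; 1; 0];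
                                   [:: 0; 1; 0; 0]; [:: -1; 0; 0; 0]]
    & pauli2 R (lit 3 2) = mx4 [:: [:: 1; 0; 0; 0]; [:: 0; -1; 0; 0];
                                   [:: 0; 0; -1; 0]; [:: 0; 0; 0; 1]]].
Proof.
rewrite /pauli2 /pauli /=; have ii := imaginary_sqr R.
by split; apply/matrixP; case=> [[|[|[|[|//]]]] k4];
  case=> [[|[|[|[|//]]]] j4]; rewrite !mxE; eval_eq; rewrite /=; ring: ii.
Qed.

(* In terms of the Bloch vector n of a unit vector (x, y), this is
   (1 - sum_k n_k^2 pauli2 k) / 2; note that n_y = 'i (x y^* - y x^* ). *)
Definition fidelity_op (R : realType) (x y : R[i]) : 'M[R[i]]_(2 * 2) :=
  2^-1 *: ((x * conjc x + y * conjc y) ^+ 2 *: 1%:M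
    + - (x * conjc y + y * conjc x) ^+ 2 *: pauli2 R (lit 3 0)
    + (x * conjc y - y * conjc x) ^+ 2 *: pauli2 R (lit 3 1)
    + - (x * conjc x - y * conjc y) ^+ 2 *: pauli2 R (lit 3 2)).

Lemma sum_outcome_row (R : realType) (psi : 'cV[R[i]]_2) :
  \sum_k (outcome_row psi k) ^t* *m outcome_row psi k =
  fidelity_op (psi 0 0) (psi 1 0).
Proof.
rewrite /fidelity_op; have [-> -> ->] := pauli2E R.
apply/matrixP => i j; rewrite summxE.
under eq_bigr => k _ do rewrite adjmx_mulmxE !outcome_row_mx4.
rewrite big_ord4 !conjC_realM.
have xE : conjc (psi 0 0) = Num.conj (psi 0 0) by [].
have yE : conjc (psi 1 0) = Num.conj (psi 1 0) by [].
rewrite xE yE; move: (psi 0 0) (psi 1 0) {xE yE} => x y.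
(* The prefactor matters only through c * c = 1/2. With it and the conjugates abstracted, every
   entry is a polynomial identity. *)
move: (invsqrt2_sqr R); move: (((Num.sqrt 2)^-1)%:C) => c.
move: 2^-1 => h cc.
have xK : Num.conj (Num.conj x) = x by exact: conjCK.
have yK : Num.conj (Num.conj y) = y by exact: conjCK.
rewrite !mxE.
case: i => [[|[|[|[|//]]]] i4]; case: j => [[|[|[|[|//]]]] j4];
  rewrite [_ == _]/= [LHS]/= [RHS]/= !(rmorphM, rmorphN) /= ?xK ?yK.
all: by move: (Num.conj x) (Num.conj y) => x' y'; ring: cc.
Qed.

Lemma Re_mxtrace_combination (R : realType) n (A P Q S : 'M[R[i]]_n)
    (a b d : R) :
  complex.Re
    (\tr (A *m (2^-1 *: (1%:M + a%:C *: P + b%:C *: Q + d%:C *: S)))) =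
  (complex.Re (\tr A) + a * complex.Re (\tr (A *m P))
   + b * complex.Re (\tr (A *m Q)) + d * complex.Re (\tr (A *m S))) / 2.
Proof.
rewrite -scalemxAr !mulmxDr -!scalemxAr mulmx1 mxtraceZ !mxtraceD !mxtraceZ.
have -> : 2^-1 = (2^-1)%:C :> R[i] by rewrite fmorphV rmorph_nat.
by rewrite Re_realM !ReD !Re_realM mulrC.
Qed.

Lemma Re_mxtrace_pauli2 (R : realType) (rho : 'M[R[i]]_(2 * 2)) (k : 'I_3) :
  complex.Re (\tr (rho *m pauli2 R k)) = corr_mx rho k k.
Proof. by rewrite mxE. Qed.

Lemma tele_fidelity_input (R : realType) (rho : 'M[R[i]]_(2 * 2))
    (theta phi : R) :
  tele_fidelity rho (input_ket theta phi) =
  complex.Re (\tr rho) / 2 +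
  \sum_k (- corr_mx rho k k / 2) * bloch theta phi k ^+ 2.
Proof.
rewrite tele_fidelityE sum_outcome_row.
have xE : input_ket theta phi 0 0 = (cos (theta / 2))%:C.
  by rewrite !mxE eqxx /= mulr1 mulr0 addr0.
have yE : input_ket theta phi 1 0 = (cos phi +i* sin phi) * (sin (theta / 2))%:C.
  by rewrite !mxE eqxx /= mulr1 mulr0 add0r.
(* The ket is written in half angles and the Bloch vector in full angles; the double-angle formulas
   connect them. *)
have thetaE : theta = (theta / 2) *+ 2 by rewrite -mulr_natr; field.
have sinE : sin theta = 2 * sin (theta / 2) * cos (theta / 2).
  by rewrite {1}thetaE sin_mulr2n -mulr_natl; ring.
have cosE : cos theta = cos (theta / 2) ^+ 2 - sin (theta / 2) ^+ 2.
  by rewrite {1}thetaE cos_mulr2n sin2cos2 -mulr_natl; ring.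
have := cos2sin2 phi; have := cos2sin2 (theta / 2).
move: sinE cosE; rewrite xE yE.
rewrite /bloch.
move: (cos (theta / 2)) (sin (theta / 2)) (cos phi) (sin phi) => c s cp sp.
move=> sinE cosE cs csp.
rewrite /fidelity_op.
set x := c%:C; set y := (cp +i* sp) * s%:C.
(* The four coefficients of [fidelity_op] become 1 and the -n_k^2. As x y^* - y x^* is purely
   imaginary, its square is -n_y^2 with no outer sign. *)
have -> : x * conjc x + y * conjc y = 1%:C.
  by apply/eqP; rewrite /x /y eq_complex /=; apply/andP; split; apply/eqP;
     ring: cs csp.
have -> : - (x * conjc y + y * conjc x) ^+ 2 = (- (sin theta * cp) ^+ 2)%:C.
  by rewrite sinE; apply/eqP; rewrite /x /y eq_complex /=; apply/andP; split;
     apply/eqP; ring: cs csp.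
have -> : (x * conjc y - y * conjc x) ^+ 2 = (- (sin theta * sp) ^+ 2)%:C.
  by rewrite sinE; apply/eqP; rewrite /x /y eq_complex /=; apply/andP; split;
     apply/eqP; ring: cs csp.
have -> : - (x * conjc x - y * conjc y) ^+ 2 = (- cos theta ^+ 2)%:C.
  by rewrite cosE; apply/eqP; rewrite /x /y eq_complex /=; apply/andP; split;
     apply/eqP; ring: cs csp.
rewrite expr1n scale1r Re_mxtrace_combination !Re_mxtrace_pauli2 big_ord3 /=.
move: (corr_mx rho _ _) (corr_mx rho _ _) (corr_mx rho _ _) (complex.Re _).
by move=> t0 t1 t2 t; field.
Qed.

Lemma avg_fidelityE (R : realType) (rho : 'M[R[i]]_(2 * 2)) :
  avg_fidelity rho = (complex.Re (\tr rho) - \tr (corr_mx rho) / 3) / 2.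
Proof.
rewrite /avg_fidelity (input_mean_quadratic (tele_fidelity_input rho)).
by rewrite -mulr_suml sumrN /mxtrace; field.
Qed.

(** For T = t 1 the sum of T_kk n_k^2 equals t on the whole sphere, so the fidelity is constant. *)
Lemma fidelity_std_isotropic (R : realType) (rho : 'M[R[i]]_(2 * 2)) (t : R) :
  corr_mx rho = diag_mx (\row_(k < 3) t) -> fidelity_std rho = 0.
Proof.
move=> rhoE; rewrite /fidelity_std (@input_mean_quadratic _ _ 0 (fun=> 0)).
  by rewrite big1 // mul0r addr0 sqrtr0.
move=> theta phi.
rewrite [in RHS]big1 => [|k _]; last by rewrite mul0r.
rewrite tele_fidelity_input avg_fidelityE rhoE mxtrace_diag.
have -> : \sum_k (- (diag_mx (\row_(l < 3) t)) k k / 2)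
    * bloch theta phi k ^+ 2 = - t / 2.
  rewrite -[RHS]mulr1 -(sum_bloch2 theta phi) mulr_sumr.
  by apply: eq_bigr => k _; rewrite !mxE eqxx mulr1n.
have -> : \sum_i (\row_(l < 3) t) 0 i = t * 3.
  rewrite (eq_bigr (fun=> t)) => [|k _]; last by rewrite mxE.
  by rewrite sumr_const card_ord mulr_natr.
by move: (complex.Re _) => a; field.
Qed.

(** * Bounds on the mean fidelity *)

(* sum_k sigma_k (x) sigma_k *)
Definition heisenberg (R : realType) : 'M[R[i]]_(2 * 2) :=
  mx4 [:: [:: 1; 0; 0; 0]; [:: 0; -1; 2; 0]; [:: 0; 2; -1; 0]; [:: 0; 0; 0; 1]].

Lemma mxtrace_corr (R : realType) (rho : 'M[R[i]]_(2 * 2)) :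
  \tr (corr_mx rho) = complex.Re (\tr (rho *m heisenberg R)).
Proof.
rewrite [LHS]/mxtrace big_ord3 -!Re_mxtrace_pauli2 -!ReD; congr complex.Re.
rewrite -!mxtraceD -!mulmxDr; congr (\tr (_ *m _)).
have [-> -> ->] := pauli2E R.
apply/matrixP => i j; rewrite !mxE.
by case: i => [[|[|[|[|//]]]] i4]; case: j => [[|[|[|[|//]]]] j4];
   rewrite /=; ring.
Qed.

(** The vector is sqrt 2 times the singlet, hence 2 in place of 4. *)
Lemma heisenberg_singlet (R : realType) :
  heisenberg R = 1%:M - 2 *: ket_proj (col4 [:: 0; 1; -1; 0]).
Proof.
apply/matrixP => i j; rewrite !mxE big_ord1 !mxE.
by case: i => [[|[|[|[|//]]]] i4]; case: j => [[|[|[|[|//]]]] j4]; eval_eq;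
   rewrite /= ?rmorphN ?rmorph1 ?rmorph0 ?rmorphN1; ring.
Qed.

(** Adding 3 gives 4 times the triplet projector; the vector (0, 1, 1, 0) has squared norm 2, hence
    its smaller weight. *)
Lemma heisenberg_triplet (R : realType) :
  heisenberg R = 4 *: ket_proj (col4 [:: 1; 0; 0; 0])
    + 4 *: ket_proj (col4 [:: 0; 0; 0; 1])
    + 2 *: ket_proj (col4 [:: 0; 1; 1; 0]) - 3%:M.
Proof.
apply/matrixP => i j; rewrite !mxE !big_ord1 !mxE.
by case: i => [[|[|[|[|//]]]] i4]; case: j => [[|[|[|[|//]]]] j4]; eval_eq;
   rewrite /= ?rmorphN ?rmorph1 ?rmorph0; ring.
Qed.

(** The eigenvalues of [heisenberg] are -3 on the singlet and 1 on the triplet space. *)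
Lemma psd_heisenberg (R : realType) (A : 'M[R[i]]_(2 * 2)) : psd A ->
  -3 * complex.Re (\tr A) <= complex.Re (\tr (A *m heisenberg R))
    <= complex.Re (\tr A).
Proof.
move=> psdA; apply/andP; split.
  rewrite heisenberg_triplet mulmxBr !mulmxDr mul_mx_scalar.
  have h1 := psd_mxtrace_proj (col4 [:: 1; 0; 0; 0]) 4 psdA.
  have h2 := psd_mxtrace_proj (col4 [:: 0; 0; 0; 1]) 4 psdA.
  have h3 := psd_mxtrace_proj (col4 [:: 0; 1; 1; 0]) 2 psdA.
  have e3 : complex.Re (\tr (3 *: A)) = 3 * complex.Re (\tr A).
    by rewrite mxtraceZ -(rmorph_nat (real_complex R)) Re_realM.
  rewrite mxtraceB ReB !mxtraceD !ReD e3 mulNr -[leLHS]add0r lerD2r.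
  exact: (addr_ge0 (addr_ge0 h1 h2) h3).
rewrite heisenberg_singlet mulmxBr mulmx1 mxtraceB ReB.
by rewrite gerBl; exact: psd_mxtrace_proj.
Qed.

Lemma max_avg_fidelity_ge (R : realType) (rho : 'M[R[i]]_(2 * 2))
    (U V : 'M[R[i]]_2) :
  psd rho -> U \is unitarymx -> V \is unitarymx ->
  avg_fidelity (local_conj U V rho) <= max_avg_fidelity rho.
Proof.
move=> psdrho uU uV; apply: ub_le_sup; last by exists U, V.
(* The supremum needs an upper bound: tr T >= -3 tr rho makes every mean at most tr rho. *)
exists (complex.Re (\tr rho)) => _ [U' [V' [uU' uV' ->]]].
rewrite avg_fidelityE mxtrace_corr mxtrace_local_conj //.
have /andP[] := psd_heisenberg (psd_conj (U' *t V') psdrho).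
rewrite mxtrace_local_conj // => h _.
by rewrite /local_conj; lra.
Qed.

(** Q = 1/2 - rho is positive of trace 1, also after local unitaries. As S = [heisenberg] is
    traceless, -tr (rho S) = tr (Q S) <= 1, so tr T >= -1 and the mean is at most (1 + 1/3) / 2. *)
Lemma max_avg_fidelity_le (R : realType) (rho : 'M[R[i]]_(2 * 2)) :
  \tr rho = 1 -> psd (2^-1%:M - rho) -> max_avg_fidelity rho <= 2 / 3.
Proof.
move=> tr_rho; set Q := _ - rho => psdQ.
apply: ge_sup.
  by exists (avg_fidelity (local_conj 1%:M 1%:M rho)), 1%:M, 1%:M;
     rewrite !unitarymx1.
move=> _ [U [V [uU uV ->]]].
have QE : local_conj U V Q = 2^-1%:M - local_conj U V rho.
  rewrite /local_conj /Q mulmxBr mulmxBl; congr (_ - _).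
  rewrite -scalemx1 -scalemxAr -scalemxAl mulmx1.
  by rewrite (mulmx1C (tens_unitary uU uV)).
have := psd_heisenberg (psd_conj (U *t V) psdQ).
rewrite -/(local_conj U V Q) mxtrace_local_conj // QE.
rewrite avg_fidelityE mxtrace_corr mxtrace_local_conj // tr_rho.
rewrite mulmxBl !mxtraceB !ReB tr_rho mxtrace_scalar.
have -> : \tr (2^-1%:M *m heisenberg R) = 0.
  by rewrite mul_scalar_mx mxtraceZ /mxtrace big_ord4 !mxE /=; ring.
have -> : 2^-1 *+ (2 * 2) = 2 :> R[i] by rewrite -mulr_natr; field.
have -> : complex.Re (2 : R[i]) = 2 by rewrite -(rmorph_nat (real_complex R)).
rewrite (_ : complex.Re (1 : R[i]) = 1) // (_ : complex.Re (0 : R[i]) = 0) //.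
by move: (complex.Re _) => t; lra.
Qed.

(** * The family of channels *)

(* (D_c A + tr A |0><0|) / 2, where D_c multiplies the off-diagonal entries of
   A by c. *)
Definition damp (R : realType) (c : R) (A : 'M[R[i]]_2) : 'M[R[i]]_2 :=
  \matrix_(i < 2, j < 2) (2^-1 *
    if i == j then (if i == 0 then 2 * A 0 0 + A 1 1 else A 1 1)
    else c%:C * A i j).

Lemma damp_is_linear (R : realType) (c : R) : linear (damp c).
Proof.
move=> a A B; apply/matrixP => i j; rewrite !mxE.
by do 2?case: ifP => _; ring.
Qed.

HB.instance Definition _ (R : realType) (c : R) :=
  GRing.isLinear.Build R[i] 'M[R[i]]_2 'M[R[i]]_2 _ (@damp R c)
    (@damp_is_linear R c).

(** A Kraus form with the weights kept outside, avoiding square roots. The first term supplies the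
    coherences, the next two complete the populations, and the last moves half of |1> to |0>. *)
Lemma damp_kraus (R : realType) (c : R) (A : 'M[R[i]]_2) : damp c A =
  (c / 2)%:C *: (1%:M *m A *m 1%:M)
  + ((2 - c) / 2)%:C *: (delta_mx 0 0 *m A *m delta_mx 0 0)
  + ((1 - c) / 2)%:C *: (delta_mx 1 1 *m A *m delta_mx 1 1)
  + 2^-1 *: (delta_mx 0 1 *m A *m delta_mx 1 0).
Proof.
rewrite !delta_mx_conj mul1mx mulmx1.
have -> : ((2 - c) / 2)%:C = (2 - c%:C) / 2 :> R[i].
  by rewrite rmorphM rmorphB fmorphV !rmorph_nat.
have -> : ((1 - c) / 2)%:C = (1 - c%:C) / 2 :> R[i].
  by rewrite rmorphM rmorphB fmorphV !rmorph_nat.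
have -> : (c / 2)%:C = c%:C / 2 :> R[i].
  by rewrite rmorphM fmorphV !rmorph_nat.
apply/matrixP => i j; rewrite !mxE.
case: i => [[|[|//]] i2]; case: j => [[|[|//]] j2]; eval_eq;
  eval_ord2; rewrite /=; by field.
Qed.

Lemma damp_completely_positive (R : realType) (c : R) :
  0 <= c <= 1 -> completely_positive (damp c).
Proof.
move=> /andP[c0 c1].
(* The right factors in [damp_kraus] are not written as adjoints, so K' is kept separate from K. *)
have cp (a : R[i]) (K K' : 'M[R[i]]_2) : K' = K ^t* -> 0 <= a ->
    completely_positive (fun A => a *: (K *m A *m K')).
  move=> -> a0.
  exact: (@completely_positiveZ R a (fun A => K *m A *m K ^t*) a0
            (@completely_positive_conj R K)).
have adj1 : (1%:M : 'M[R[i]]_2) = 1%:M ^t* by rewrite trmx1 map_mx1.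
have adjd i j : (delta_mx i j : 'M[R[i]]_2) = (delta_mx j i) ^t*.
  by apply/matrixP => k l; rewrite !mxE rmorph_nat andbC.
have h1 : 0 <= (c / 2)%:C by rewrite ler0c; lra.
have h2 : 0 <= ((2 - c) / 2)%:C by rewrite ler0c; lra.
have h3 : 0 <= ((1 - c) / 2)%:C by rewrite ler0c; lra.
have h4 : 0 <= (2^-1 : R[i]) by rewrite invr_ge0 ler0n.
rewrite (funext (damp_kraus c)).
exact: (completely_positiveD (completely_positiveD (completely_positiveD
  (cp _ _ _ adj1 h1) (cp _ _ _ (adjd 0 0) h2)) (cp _ _ _ (adjd 1 1) h3))
  (cp _ _ _ (adjd 1 0) h4)).
Qed.

Lemma damp_trace_preserving (R : realType) (c : R) : trace_preserving (damp c).
Proof.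
move=> A; rewrite /mxtrace !big_ord2 !mxE.
by eval_eq; eval_ord2; rewrite /=; field.
Qed.

(** * Choi states of the family and their rank *)

Lemma choi_damp (R : realType) (c : R) : choi_state (@damp R c) =
  mx4 [:: [:: 2^-1; 0; 0; c%:C / 4]; [:: 0; 0; 0; 0];
          [:: 0; 0; 4^-1; 0]; [:: c%:C / 4; 0; 0; 4^-1]].
Proof.
rewrite /choi_state /ket_proj /id_tens.
apply/matrixP => i j.
rewrite summxE big_ord2 !summxE !big_ord2.
rewrite ![(_ *t _) _ _]mxE ![damp _ _ _ _]mxE.
set b := tens_block.
(* Block (i', j') of |Phi1><Phi1| is |i'><j'| / 2. *)
have bE i' j' k l : b R 2 (Phi1 R *m (Phi1 R) ^t*) i' j' k l =
    2^-1 * (i' == k)%:R * (j' == l)%:R.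
  rewrite /b !mxE big_ord1.
  have phiE p q : Phi1 R (mxtens_index (p, q)) 0 =
      ((Num.sqrt 2)^-1)%:C * (p == q)%:R.
    rewrite !mxE !mxtens_indexK; eval_eq; rewrite !andbT.
    congr (_ * _); case: p => [[|[|//]] ?]; case: q => [[|[|//]] ?];
      eval_eq; rewrite /=; ring.
  rewrite phiE [_^t* _ _]mxE [_^T _ _]mxE phiE.
  by rewrite conjC_realM rmorph_nat mulrACA invsqrt2_sqr mulrA.
rewrite !bE.
rewrite ![delta_mx _ _ _ _]mxE ![mx4 _ _ _]mxE.
case: i => [[|[|[|[|//]]]] i4]; case: j => [[|[|[|[|//]]]] j4]; eval_eq;
  rewrite /=.
all: by field.
Qed.

Lemma mxtrace_choi_damp (R : realType) (c : R) : \tr (choi_state (@damp R c)) = 1.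
Proof. by rewrite choi_damp /mxtrace big_ord4 !mxE /=; field. Qed.

Lemma rank_choi_damp (R : realType) (c : R) : 0 <= c <= 1 ->
  \rank (choi_state (@damp R c)) = 3%N.
Proof.
move=> /andP[c0 c1]; rewrite choi_damp; set A := mx4 _.
suff rk : \rank (kermx A) = 1%N.
  move: (mxrank_ker A) (rank_leq_row A); rewrite rk.
  by case: (\rank A) => [|[|[|[|[|]]]]].
suff /eqmxP -> : (kermx A == (delta_mx 0 (lit 4 1) : 'rV[R[i]]_(2 * 2)))%MS.
  exact: mxrank_delta.
apply/andP; split; last first.
  apply/sub_kermxP/matrixP => i j; rewrite ord1 -rowE !mxE.
  by case: j => [[|[|[|[|//]]]] ?].
apply/row_subP => i; have /sub_kermxP := row_sub i (kermx A).
move: (row i (kermx A)) => v vA.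
have vAE j : \sum_k v 0 k * A k j = 0.
  have := congr1 (fun B : 'rV_(2 * 2) => B 0 j) vA.
  by rewrite [LHS]mxE [RHS]mxE.
move: (vAE (lit 4 0)) (vAE (lit 4 2)) (vAE (lit 4 3)).
rewrite !big_ord4 /A /mx4 ![(\matrix_(_ < _, _ < _) _) _ _]mxE /=.
set v0 := v 0 _; set v1 := v 0 _; set v2 := v 0 _; set v3 := v 0 _.
rewrite !(mulr0, addr0, add0r) => e0 e2 e3.
(* This is 16 times the determinant of the block on |00> and |11>. *)
have c2 : 2 - c%:C ^+ 2 != 0.
  rewrite -(rmorph_nat (real_complex R)) -rmorphXn -rmorphB fmorph_eq0.
  by apply: lt0r_neq0; nra.
have v20 : v2 = 0.
  by move/eqP: e2; rewrite mulf_eq0 invr_eq0 pnatr_eq0 orbF => /eqP.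
have v3E : v3 = - c%:C * v0.
  have -> : v3 = 4 * (v0 * (c%:C / 4) + v3 / 4) - c%:C * v0 by field.
  by rewrite e3 mulr0 sub0r mulNr.
have v00 : v0 = 0.
  apply/eqP; rewrite -(mulrI_eq0 _ (mulfI c2)); apply/eqP.
  have -> : (2 - c%:C ^+ 2) * v0 = 4 * (v0 / 2 + - c%:C * v0 * (c%:C / 4)).
    by field.
  by rewrite -v3E e0 mulr0.
have -> : v = v1 *: delta_mx 0 (lit 4 1).
  apply/rowP => j; rewrite [RHS]mxE [delta_mx _ _ _ _]mxE.
  case: j => [[|[|[|[|//]]]] j4]; eval_eq; rewrite ?mulr1 ?mulr0.
  - by rewrite -[RHS]v00; congr (v 0 _); exact: val_inj.
  - by congr (v 0 _); exact: val_inj.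
  - by rewrite -[RHS]v20; congr (v 0 _); exact: val_inj.
  - rewrite -[RHS](_ : v3 = 0); last by rewrite v3E v00 mulr0.
    by congr (v 0 _); exact: val_inj.
exact: scalemx_sub.
Qed.

Lemma damp_C3 (R : realType) (c : R) : 0 <= c <= 1 -> C3 (@damp R c).
Proof.
move=> c01; split; last exact: rank_choi_damp.
by split; [exact: damp_completely_positive | exact: damp_trace_preserving].
Qed.

(** * The two extreme members of the family *)

Lemma max_avg_fidelity_damp0 (R : realType) :
  max_avg_fidelity (choi_state (@damp R 0)) <= 2 / 3.
Proof.
apply: max_avg_fidelity_le; first exact: mxtrace_choi_damp.
(* The Choi state is diag (1/2, 0, 1/4, 1/4), so the difference is diag (0, 1/2, 1/4, 1/4). *)
have -> : 2^-1%:M - choi_state (@damp R 0) =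
    4^-1 *: (2%:R *: ket_proj (col4 [:: 0; 1; 0; 0])
             + ket_proj (col4 [:: 0; 0; 1; 0])
             + ket_proj (col4 [:: 0; 0; 0; 1])).
  apply/matrixP => i j; rewrite choi_damp !mxE !big_ord1 !mxE.
  by case: i => [[|[|[|[|//]]]] i4]; case: j => [[|[|[|[|//]]]] j4]; eval_eq;
     rewrite /= ?rmorph1 ?rmorph0; field.
apply: psdZ; first by rewrite invr_ge0 ler0n.
apply: psdD; last exact: psd_ket_proj.
apply: psdD; last exact: psd_ket_proj.
by apply: psdZ; [exact: ler0n | exact: psd_ket_proj].
Qed.

Lemma pauli_y_unitary (R : realType) : pauli R (lit 4 2) \is unitarymx.
Proof.
apply/unitarymxP/matrixP => i j.
have ii := imaginary_sqr R; have ic := conj_imaginary R.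
rewrite mxE big_ord2 /pauli /= !mxE.
case: i => [[|[|//]] i2]; case: j => [[|[|//]] j2]; eval_eq;
  rewrite /= !(rmorphM, rmorphB, rmorph0, rmorph1) /= ?ic; ring: ii.
Qed.

Lemma local_conj_damp1 (R : realType) :
  local_conj (pauli R (lit 4 2)) 1%:M (choi_state (@damp R 1)) =
  mx4 [:: [:: 4^-1; 0; 0; 0]; [:: 0; 4^-1; - 4^-1; 0];
          [:: 0; - 4^-1; 2^-1; 0]; [:: 0; 0; 0; 0]].
Proof.
have ii := imaginary_sqr R; have ic := conj_imaginary R.
pose W : 'M[R[i]]_(2 * 2) :=
  mx4 [:: [:: 0; 0; - Num.imaginary; 0]; [:: 0; 0; 0; - Num.imaginary];
          [:: Num.imaginary; 0; 0; 0]; [:: 0; Num.imaginary; 0; 0]].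
have WE : pauli R (lit 4 2) *t 1%:M = W.
  apply/matrixP => i j; rewrite /pauli /= !mxE.
  by case: i => [[|[|[|[|//]]]] i4]; case: j => [[|[|[|[|//]]]] j4]; eval_eq;
     rewrite /=; ring.
have Wadj : W ^t* = W.
  apply/matrixP => i j; rewrite !mxE.
  by case: i => [[|[|[|[|//]]]] i4]; case: j => [[|[|[|[|//]]]] j4];
     rewrite /= ?(rmorph0, rmorphN) /= ?ic ?opprK.
rewrite /local_conj WE Wadj choi_damp; clear Wadj WE; rewrite /W.
apply/matrixP => i j; rewrite [LHS]mxE big_ord4 ![(_ *m mx4 _) _ _]mxE !big_ord4.
rewrite /mx4 ![(\matrix_(_, _) _) _ _]mxE.
case: i => [[|[|[|[|//]]]] i4]; case: j => [[|[|[|[|//]]]] j4]; rewrite /=.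
all: rewrite ?(mul0r, mulr0, add0r, addr0).
all: by field: ii.
Qed.

(** The X shape kills the correlations of sigma_z with sigma_x and sigma_y; the symmetry of the
    antidiagonal kills those of sigma_x with sigma_y. *)
Lemma mxtrace_Xstate_pauli (R : realType) (a b d e u w : R[i]) (i j : 'I_3) :
  \tr (mx4 [:: [:: a; 0; 0; u]; [:: 0; b; w; 0];
               [:: 0; w; d; 0]; [:: u; 0; 0; e]]
       *m (pauli R (lift ord0 i) *t pauli R (lift ord0 j))) =
  if i == j then [:: 2 * (w + u); 2 * (w - u); a - b - d + e]`_i else 0.
Proof.
have ii := imaginary_sqr R.
rewrite /mxtrace big_ord4.
rewrite ![(mx4 _ *m _) _ _]mxE !big_ord4 /mx4 ![(\matrix_(_, _) _) _ _]mxE.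
rewrite /= !(mul0r, mulr0, add0r, addr0) /pauli.
case: i => [[|[|[|//]]] i3]; case: j => [[|[|[|//]]] j3];
  rewrite /= !mxE; eval_eq; rewrite /=.
all: by ring: ii.
Qed.

Lemma corr_mx_Xstate (R : realType) (a b d e u w : R[i]) (t : 'I_3 -> R) :
  2 * (w + u) = (t (lit 3 0))%:C -> 2 * (w - u) = (t (lit 3 1))%:C ->
  a - b - d + e = (t (lit 3 2))%:C ->
  corr_mx (mx4 [:: [:: a; 0; 0; u]; [:: 0; b; w; 0];
                   [:: 0; w; d; 0]; [:: u; 0; 0; e]]) = diag_mx (\row_k t k).
Proof.
move=> t0 t1 t2; apply/matrixP => i j; rewrite mxE mxtrace_Xstate_pauli !mxE.
case: (i =P j) => [_|_] //; rewrite mulr1n.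
by case: i => [[|[|[|//]]] i3]; rewrite /= ?t0 ?t1 ?t2; congr (t _);
   exact: val_inj.
Qed.

Lemma corr_damp1 (R : realType) : corr_mx (choi_state (@damp R 1)) =
  diag_mx (\row_(k < 3) (if k == lit 3 1 then - 2^-1 else 2^-1)).
Proof.
rewrite choi_damp; apply: corr_mx_Xstate; eval_eq;
rewrite ?rmorphN fmorphV rmorph_nat ?rmorph1; by field.
Qed.

Lemma corr_local_conj_damp1 (R : realType) :
  corr_mx (local_conj (pauli R (lit 4 2)) 1%:M (choi_state (@damp R 1))) =
  diag_mx (\row_(k < 3) - 2^-1).
Proof.
rewrite local_conj_damp1; apply: corr_mx_Xstate;
rewrite rmorphN fmorphV rmorph_nat; by field.
Qed.

Lemma canonical_form_damp1 (R : realType) :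
  correlation_canonical_form (choi_state (@damp R 1))
    (local_conj (pauli R (lit 4 2)) 1%:M (choi_state (@damp R 1))).
Proof.
(* All singular values are 1/2, so any index is a smallest one; the determinant is -1/8, so every
   sign is -1. *)
exists (pauli R (lit 4 2)), 1%:M, (fun=> 2^-1), ord0.
split; first by split; [exact: pauli_y_unitary | exact: unitarymx1 |].
rewrite corr_local_conj_damp1 corr_damp1; split => //.
- split=> [_|]; first by rewrite invr_ge0 ler0n.
  rewrite prodr_const card_ord -char_poly_scalar; congr char_poly.
  rewrite tr_diag_mx mulmx_diag; apply/matrixP => i j; rewrite !mxE.
  by case: ifP => _; rewrite ?mulrNN expr2.
- rewrite det_diag !big_ord_recr big_ord0 /= !mxE; eval_eq; rewrite /=.
  rewrite (_ : (0 < _) = false) /=; last by apply/negbTE; rewrite -leNgt; lra.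
  by congr diag_mx; apply/rowP => k; rewrite !mxE /= mulN1r.
Qed.

Lemma damp1_useful (R : realType) : useful_for_UQT (choi_state (@damp R 1)).
Proof.
have c1 : 0 <= (1 : R) <= 1 by rewrite ler01 /=.
split.
  have psdrho := psd_choi (damp_completely_positive c1).
  apply: lt_le_trans
    (max_avg_fidelity_ge psdrho (pauli_y_unitary R) (unitarymx1 _ _)).
  (* With tr T = -3/2 the mean is (1 + 1/2) / 2 = 3/4. *)
  rewrite avg_fidelityE corr_local_conj_damp1.
  rewrite mxtrace_local_conj ?pauli_y_unitary ?unitarymx1 //.
  rewrite mxtrace_choi_damp mxtrace_diag big_ord3 !mxE.
  by rewrite (_ : complex.Re (1 : R[i]) = 1) //; lra.
exists (local_conj (pauli R (lit 4 2)) 1%:M (choi_state (@damp R 1))).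
  exact: canonical_form_damp1.
by rewrite (fidelity_std_isotropic (corr_local_conj_damp1 R)).
Qed.

Theorem proposition3 (R : realType) :
  @U3 R !=set0 /\ @U3 R `<` @C3 R.
Proof.
split.
  exists (@damp R 1); split; last exact: damp1_useful.
  by apply: damp_C3; rewrite ler01 /=.
split; first by move=> L [].
move=> sub.
(* The reverse inclusion would make the Choi state for c = 0 useful, against its bound 2/3. *)
have C3damp0 : C3 (@damp R 0) by apply: damp_C3; rewrite ler01 andbT.
by have [_ [+ _]] := sub _ C3damp0; rewrite ltNge max_avg_fidelity_damp0.
Qed.
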